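(* Let $n$ be a natural number and let $A$ be an $n^2\times n^2$ $R$-matrix such that $A^2$ is the identity matrix. For each $\alpha\in\mathbb{C}$ the matrix $R(x)=I_{n^2}+\alpha xA$ (where $x$ is the variable) is a solution of the parameter-dependent Yang-Baxter equation: $$(R(x)\otimes I_n)(I_n\otimes R(x+y))(R(y)\otimes I_n)=(I_n\otimes R(y))(R(x+y)\otimes I_n)(I_n\otimes R(x)).$$
   Context: $I_k$ is the $k\times k$ identity matrix and $\otimes$ is the Kronecker product. An $R$-matrix is a nonsingular complex $n^2\times n^2$ matrix $R$ with $(R\otimes I_n)(I_n\otimes R)(R\otimes I_n)=(I_n\otimes R)(R\otimes I_n)(I_n\otimes R)$. The variables $x,y$ are complex. *)

(* Defs.v *)
From mathcomp Require Import all_boot all_order all_algebra.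
From mathcomp Require Import complex mxtens reals.

Set Implicit Arguments.
Unset Strict Implicit.
Unset Printing Implicit Defensive.

Import GRing.Theory.
Local Open Scope ring_scope.

(* [B *t C] is the Kronecker product: rows and columns of the left factor are
   the most significant digits of the product index.  The casts below only
   identify the dimensions n ^ 2 * n and n * n ^ 2 with n ^ 3; they leave the
   entries and the (numerical values of the) indices unchanged. *)

Definition tens_id_r (K : pzRingType) (n : nat) (B : 'M[K]_(n ^ 2)) :
    'M[K]_(n ^ 3) :=
  castmx (esym (expnSr n 2), esym (expnSr n 2)) (B *t (1%:M : 'M[K]_n)).

Definition tens_id_l (K : pzRingType) (n : nat) (B : 'M[K]_(n ^ 2)) :
    'M[K]_(n ^ 3) :=
  castmx (esym (expnS n 2), esym (expnS n 2)) ((1%:M : 'M[K]_n) *t B).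

Definition is_Rmatrix (R : realType) (n : nat) (B : 'M[R[i]]_(n ^ 2)) : Prop :=
  B \in unitmx /\
  tens_id_r B *m tens_id_l B *m tens_id_r B =
  tens_id_l B *m tens_id_r B *m tens_id_l B.

Definition parametric_YBE_solution (R : realType) (n : nat)
    (B : R[i] -> 'M[R[i]]_(n ^ 2)) : Prop :=
  forall x y : R[i],
    tens_id_r (B x) *m tens_id_l (B (x + y)) *m tens_id_r (B y) =
    tens_id_l (B y) *m tens_id_r (B (x + y)) *m tens_id_l (B x).

(* Main.v *)
Require Import Defs.
From mathcomp Require Import all_boot all_order all_algebra.
From mathcomp Require Import complex mxtens reals.
From mathcomp Require Import ring.

Import GRing.Theory.
Local Open Scope ring_scope.

(** Write [P] for [A] tensored with the identity on the right and [Q] for [A]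
    tensored with the identity on the left.  Tensoring with the identity is a
    unital algebra morphism, so the hypotheses on [A] become P^2 = Q^2 = 1 and
    PQP = QPQ, and the claim becomes, with a = alpha x and b = alpha y,
    (1 + aP)(1 + (a+b)Q)(1 + bP) = (1 + bQ)(1 + (a+b)P)(1 + aQ).
    Expanding, both sides share the terms 1 + (a+b)P + (a+b)Q + a(a+b)PQ +
    b(a+b)QP; what remains is ab P^2 + ab(a+b) PQP on the left and
    ab Q^2 + ab(a+b) QPQ on the right.  The middle parameter a+b is what
    makes the linear terms agree.  This is [baxterization_involutive]. *)

Lemma castmx_mulmx (K : pzRingType) (m p : nat) (e : m = p) (B C : 'M[K]_m) :
  castmx (e, e) (B *m C) = castmx (e, e) B *m castmx (e, e) C.
Proof. by case: p / e. Qed.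

Lemma castmx_scalar (K : pzRingType) (m p : nat) (e : m = p) (c : K) :
  castmx (e, e) c%:M = c%:M.
Proof. by case: p / e. Qed.

Lemma tensmx11 (K : pzRingType) (m p : nat) :
  (1%:M : 'M[K]_m) *t (1%:M : 'M[K]_p) = 1%:M.
Proof.
apply/matrixP=> i j.
case: (mxtens_indexP i) => i0 i1; case: (mxtens_indexP j) => j0 j1.
rewrite tensmxE !mxE -natrM mulnb.
by rewrite (inj_eq (can_inj (@mxtens_indexK m p))) xpair_eqE.
Qed.

Lemma tens_id_rM (K : comPzRingType) (n : nat) (B C : 'M[K]_(n ^ 2)) :
  tens_id_r (B *m C) = tens_id_r B *m tens_id_r C.
Proof. by rewrite /tens_id_r -castmx_mulmx tensmx_mul mulmx1. Qed.

Lemma tens_id_lM (K : comPzRingType) (n : nat) (B C : 'M[K]_(n ^ 2)) :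
  tens_id_l (B *m C) = tens_id_l B *m tens_id_l C.
Proof. by rewrite /tens_id_l -castmx_mulmx tensmx_mul mulmx1. Qed.

Lemma tens_id_r1 (K : comPzRingType) (n : nat) :
  tens_id_r (1%:M : 'M[K]_(n ^ 2)) = 1%:M.
Proof. by rewrite /tens_id_r tensmx11 castmx_scalar. Qed.

Lemma tens_id_l1 (K : comPzRingType) (n : nat) :
  tens_id_l (1%:M : 'M[K]_(n ^ 2)) = 1%:M.
Proof. by rewrite /tens_id_l tensmx11 castmx_scalar. Qed.

Lemma tens_id_rDZ (K : comPzRingType) (n : nat) (c : K) (B C : 'M[K]_(n ^ 2)) :
  tens_id_r (B + c *: C) = tens_id_r B + c *: tens_id_r C.
Proof.
by apply/matrixP=> i j; rewrite !(castmxE, mxE) mulrDl mulrA.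
Qed.

Lemma tens_id_lDZ (K : comPzRingType) (n : nat) (c : K) (B C : 'M[K]_(n ^ 2)) :
  tens_id_l (B + c *: C) = tens_id_l B + c *: tens_id_l C.
Proof.
by apply/matrixP=> i j; rewrite !(castmxE, mxE) mulrDr mulrCA.
Qed.

Lemma mulmx_1DZ3 (K : comPzRingType) (m : nat) (a b c : K) (P Q : 'M[K]_m) :
  (1%:M + a *: P) *m (1%:M + c *: Q) *m (1%:M + b *: P) =
  1%:M + (a + b) *: P + c *: Q + (a * b) *: (P *m P) + (a * c) *: (P *m Q)
    + (c * b) *: (Q *m P) + (a * b * c) *: (P *m Q *m P).
Proof.
rewrite !(mulmxDl, mulmxDr, mulmx1, mul1mx) -!(scalemxAl, scalemxAr) !scalerA.
(* With the products opaque, the identity is linear in the entries. *)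
move: (P *m Q *m P) (P *m P) (P *m Q) (Q *m P) => PQP PP PQ QP.
by apply/matrixP=> i j; rewrite !mxE; ring.
Qed.

(** Exchanging [P] with [Q] and [a] with [b] turns the left-hand side into the
    right-hand side and preserves every term of [mulmx_1DZ3] except the square
    and the cubic one, whose scalar coefficients [a * b] and
    [a * b * (a + b)] are symmetric in [a] and [b]; the two hypotheses identify
    exactly these. *)
Lemma baxterization_involutive (K : comPzRingType) (m : nat) (a b : K)
    (P Q : 'M[K]_m) :
  P *m P = Q *m Q -> P *m Q *m P = Q *m P *m Q ->
  (1%:M + a *: P) *m (1%:M + (a + b) *: Q) *m (1%:M + b *: P) =
  (1%:M + b *: Q) *m (1%:M + (a + b) *: P) *m (1%:M + a *: Q).
Proof.
move=> sqPQ braidPQ; rewrite !mulmx_1DZ3 sqPQ braidPQ.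
move: (Q *m P *m Q) (Q *m Q) (P *m Q) (Q *m P) => QPQ QQ PQ QP.
by apply/matrixP=> i j; rewrite !mxE; ring.
Qed.

Theorem proposition18 (R : realType) (n : nat) (A : 'M[R[i]]_(n ^ 2))
    (hA : is_Rmatrix A) (hA2 : A ^+ 2 = 1%:M) (alpha : R[i]) :
  parametric_YBE_solution (fun x : R[i] => 1%:M + (alpha * x) *: A).
Proof.
move=> x y; rewrite !tens_id_rDZ !tens_id_lDZ tens_id_r1 tens_id_l1 mulrDr.
have A2 : A *m A = 1%:M by rewrite -hA2 expr2.
apply: baxterization_involutive; last by case: hA.
by rewrite -tens_id_rM -tens_id_lM A2 tens_id_r1 tens_id_l1.
Qed.
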